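(* Let $X$ be a non-negative continuous random variable with density $f$, distribution function $F$ and finite mean, and let $X_1,X_2$ be two independent random variables each having distribution function $F$. Then $$-\frac12\int_0^\infty x\,\big(1-F^2(x)\big)\,dx=-\frac14\,E\big(\max(X_1,X_2)^2\big).$$
   Context: The left-hand side is the weighted cumulative extropy $H(X,w)$ of $X$. $F^2(x)$ means $(F(x))^2$. Both sides are understood as elements of $[-\infty,0]$ (integrals of non-negative functions, up to sign). *)

(* Defs.v *)
From HB Require Import structures.
From mathcomp Require Import all_boot all_order all_algebra.
From mathcomp Require Import all_classical all_reals all_analysis.
Set Implicit Arguments.
Unset Strict Implicit.
Unset Printing Implicit Defensive.
Import Order.TTheory GRing.Theory Num.Theory.
Import numFieldNormedType.Exports.
Local Open Scope classical_set_scope.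
Local Open Scope ring_scope.
Local Open Scope ereal_scope.

Definition has_density (R : realType) (d : measure_display)
    (T : measurableType d) (P : probability T R) (X : {RV P >-> R})
    (f : R -> R) : Prop :=
  [/\ measurable_fun [set: R] f,
      (forall x, (0 <= f x)%R) &
      forall A : set R, measurable A ->
        distribution P X A = \int[lebesgue_measure]_(x in A) (f x)%:E].

Definition independent_RVs (R : realType) (d : measure_display)
    (T : measurableType d) (P : probability T R) (X Y : {RV P >-> R}) : Prop :=
  forall A B : set R, measurable A -> measurable B ->
    P (X @^-1` A `&` Y @^-1` B) = P (X @^-1` A) * P (Y @^-1` B).

(* Main.v *)
(** Tonelli applied to (n + 1) s^n on [0 <= s < X t] gives the tail formula
    E[X^(n+1)] = int_0^oo (n + 1) s^n P(X > s) ds for X >= 0 a.s. Take n = 1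
    and X := max(X1, X2), whose distribution function is F^2 by independence.
    The non-negativity hypothesis is on another probability space than X1 and
    X2; it is transferred because it only depends on the distribution function. *)
Require Import Defs.
From HB Require Import structures.
From mathcomp Require Import all_boot all_order all_algebra.
From mathcomp Require Import all_classical all_reals all_analysis.
From mathcomp Require Import measurable_realfun ring.
Import Order.TTheory GRing.Theory Num.Theory.
Import numFieldNormedType.Exports.
Local Open Scope classical_set_scope.
Local Open Scope ring_scope.
Local Open Scope ereal_scope.

(** Fundamental theorem of calculus with primitive [s ^+ n.+1]. The interval is open at [b] to match
    the strict event [X > s] measured by [ccdf]. *)
Lemma integral_exprS (R : realType) (n : nat) (b : R) : (0 <= b)%R ->
  \int[lebesgue_measure]_(s in `[0%R, b[) (n.+1%:R * s ^+ n)%:E =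
  (b ^+ n.+1)%:E.
Proof.
have cf : continuous (fun s : R => n.+1%:R * s ^+ n)%R.
  by move=> s; apply: cvgM; [exact: cvg_cst | exact: exprn_continuous].
(* [continuous_FTC2] wants a nondegenerate interval; for [b = 0] the domain is empty and the power
   vanishes. *)
rewrite le_eqVlt => /predU1P[<-|b0].
  by rewrite set_itvco0 integral_set0 expr0n.
rewrite integral_itv_bndo_bndc; last first.
  apply/measurable_EFinP; apply: measurable_funTS.
  exact: continuous_measurable_fun.
rewrite (@continuous_FTC2 _ _ (fun s : R => s ^+ n.+1)%R)//.
- by rewrite expr0n/= sube0.
- exact: continuous_subspaceT.
- split.
  + by move=> s _; exact: exprn_derivable.
  + exact/cvg_at_right_filter/exprn_continuous.
  + exact/cvg_at_left_filter/exprn_continuous.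
- by move=> s _; rewrite exp_derive1.
Qed.

Lemma expectation_exprS_ccdf (R : realType) (d : measure_display)
    (T : measurableType d) (P : probability T R) (X : {RV P >-> R}) (n : nat) :
  {ae P, forall t, (0 <= X t)%R} ->
  'E_P[fun t => (X t ^+ n.+1)%R] =
  \int[lebesgue_measure]_(s in `[0%R, +oo[) ((n.+1%:R * s ^+ n)%:E * ccdf X s).
Proof.
move=> X0; rewrite unlock.
pose mu := @lebesgue_measure R.
pose GR := measurableTypeR R.
pose g (s : R) := (n.+1%:R * s ^+ n)%R.
have mg : measurable_fun setT g.
  by apply: measurable_funM => //; exact: exprn_measurable.
(* The region under the graph of [X]. The bound [0 <= p.2] makes [g p.2 * \1_A p] non-negative on
   the whole product, as Tonelli requires. *)
pose A : set (T * GR) := [set p | 0 <= p.2 < X p.1]%R.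
have mA : measurable A.
  pose u (p : T * GR) := (0 <= p.2)%R.
  pose v (p : T * GR) := (p.2 < X p.1)%R.
  have mu_ : measurable_fun setT u by exact: measurable_fun_ler.
  have mv : measurable_fun setT v.
    by apply: measurable_fun_ltr => //; exact: measurableT_comp.
  rewrite (_ : A = u @^-1` [set true] `&` v @^-1` [set true]); last first.
    by apply/seteqP; split => p /andP.
  apply: measurableI.
  - by rewrite -[X in measurable X]setTI; exact: mu_.
  - by rewrite -[X in measurable X]setTI; exact: mv.
pose f (p : T * GR) := (g p.2 * \1_A p)%:E.
have mf : measurable_fun setT f.
  apply/measurable_EFinP; apply: measurable_funM.
    exact: measurableT_comp.
  exact: measurable_indic.
have f0 p : 0 <= f p.
  rewrite lee_fin indicE; have [|_] := boolP (p \in A); last by rewrite mulr0.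
  by rewrite inE => /andP[p0 _]; rewrite mulr1 mulr_ge0// exprn_ge0.
(* Where [X t] is non-negative, the inner integral is [X t ^+ n.+1] by [integral_exprS]; hence only
   an almost-everywhere equality. *)
transitivity (\int[P]_t \int[mu]_s f (t, s)).
  apply: ae_eq_integral => //.
  - by apply/measurable_EFinP; exact: measurable_funX.
  - exact: measurable_fun_fubini_tonelli_F.
  - apply: filterS X0 => t Xt0 _.
    rewrite -integral_exprS// [LHS]integral_mkcond; apply: eq_integral => s _.
    rewrite patchE /f indicE (_ : (_ \in A) = (s \in `[0%R, X t[%classic)).
      by case: ifPn => _; rewrite ?mulr1 ?mulr0.
    by apply/idP/idP; rewrite !inE.
rewrite (fubini_tonelli _ mf f0) [RHS]integral_mkcond.
(* After the swap, the section of [A] at [s] is empty for [s < 0] and is the event [X > s] for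
   [s >= 0]. *)
apply: eq_integral => s _; rewrite patchE; case: ifPn => s0; last first.
  apply: integral0_eq => t _.
  rewrite /f indicE memNset ?mulr0// => -[/= /andP[ss _]].
  by move/negP: s0; apply; rewrite inE/= in_itv/= ss.
have {}s0 : (0 <= s)%R by move: s0; rewrite inE/= in_itv/= andbT.
have mXs : measurable (X @^-1` `]s, +oo[) by exact: measurable_funPTI.
have fs t : f (t, s) = (g s)%:E * (\1_(X @^-1` `]s, +oo[) t)%:E.
  rewrite /f EFinM !indicE; congr (_ * (nat_of_bool _)%:R%:E).
  by apply/idP/idP; rewrite !inE/= in_itv/= andbT /A/= s0.
under eq_integral do rewrite fs.
rewrite ge0_integralZl//=.
- by rewrite integral_indic// setIT.
- by apply/measurable_EFinP; exact: measurable_indic.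
- by rewrite lee_fin mulr_ge0// exprn_ge0.
Qed.

Lemma ae_ge0_cdf (R : realType) (d : measure_display) (T : measurableType d)
    (P : probability T R) (X : {RV P >-> R}) :
  {ae P, forall t, (0 <= X t)%R} <-> forall x, (x < 0)%R -> cdf X x = 0.
Proof.
split=> [[N [mN N0 XN]] x x0|X0].
  apply: (subset_measure0 _ mN _ N0); first exact: measurable_funPTI.
  move=> t/=; rewrite in_itv/= => tx; apply: XN => /=.
  by apply/negP; rewrite -ltNge (le_lt_trans tx).
(* The cdf controls only events [X <= x] with [x < 0], so the event [X < 0] is covered by countably
   many of them, each null. *)
apply: (@negligibleS _ _ _ _ (\bigcup_n (X @^-1` `]-oo, (- n.+1%:R^-1)%R]))).
  move=> t /= /negP; rewrite -ltNge => Xt0.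
  have /ltr_add_invr[k] : (X t < 0)%R by [].
  rewrite -ltrBrDr sub0r => /ltW Xtk.
  by exists k => //=; rewrite in_itv/=.
apply: negligible_bigcup => n; apply/negligibleP.
  exact: measurable_funPTI.
by apply: X0; rewrite oppr_lt0 invr_gt0.
Qed.

(** A maximum is at most [x] exactly when both variables are, so independence applies to two
    half-lines. *)
Lemma cdf_max (R : realType) (d : measure_display) (T : measurableType d)
    (P : probability T R) (X Y : {RV P >-> R}) (x : R) :
  independent_RVs X Y ->
  cdf (max_mfun X Y : {RV P >-> R}) x = cdf X x * cdf Y x.
Proof.
move=> XY; rewrite /cdf /distribution /pushforward/= -XY//; congr (P _).
by apply/seteqP; split => t /=; rewrite !in_itv/= ge_max => /andP.
Qed.

Theorem mainTheorem8 (R : realType)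
    (d : measure_display) (T : measurableType d) (P : probability T R)
    (X : {RV P >-> R}) (f : R -> R)
    (X_ge0 : {ae P, forall t, (0 <= X t)%R})
    (X_density : has_density X f)
    (X_mean : P.-integrable [set: T] (EFin \o X))
    (d' : measure_display) (T' : measurableType d') (Q : probability T' R)
    (X1 X2 : {RV Q >-> R})
    (X1_cdf : forall x : R, cdf X1 x = cdf X x)
    (X2_cdf : forall x : R, cdf X2 x = cdf X x)
    (X12_indep : independent_RVs X1 X2) :
  (- 2^-1)%:E *
    \int[lebesgue_measure]_(x in `[0%R, +oo[) (x%:E * (1 - cdf X x ^+ 2)) =
  (- 4^-1)%:E * 'E_Q[fun t => (Num.max (X1 t) (X2 t) ^+ 2)%R].
Proof.
pose M : {RV Q >-> R} := max_mfun X1 X2.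
have cdfM x : cdf M x = cdf X x ^+ 2.
  by rewrite cdf_max// X1_cdf X2_cdf.
have M_ge0 : {ae Q, forall t, (0 <= M t)%R}.
  apply/ae_ge0_cdf => x x0.
  by rewrite cdfM ((ae_ge0_cdf _ _ _ _ _).1 X_ge0)// expe2 mule0.
rewrite (expectation_exprS_ccdf _ _ _ _ M 1 M_ge0).
have ccdfM x : 1 - cdf X x ^+ 2 = ccdf M x by rewrite ccdf_1_cdf cdfM.
under eq_integral do rewrite ccdfM.
under [in RHS]eq_integral do rewrite expr1 EFinM -muleA.
(* The factor 2 from [2 * s] leaves the right-hand integral, and [-1/4 * 2 = -1/2] matches the
   left-hand constant. *)
rewrite ge0_integralZl//=.
- by rewrite muleA -EFinM; congr (_%:E * _); field.
- apply: emeasurable_funM; first exact/measurable_EFinP/measurable_id.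
  exact: measurable_funTS (ccdf_measurable _).
- move=> x; rewrite in_itv/= andbT => x0.
  by rewrite mule_ge0// lee_fin.
Qed.
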